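(* Let $n\geq 3$ and let $(J,\langle\cdot,\cdot\rangle)$ be an almost Hermitian structure on a $2n$-dimensional almost abelian Lie algebra $\mathfrak{g}=\mathbb{R}e_0\ltimes_L\mathbb{R}^{2n-1}$, with $L=\begin{bmatrix}\mu & w_0^t\\ v_0& D\end{bmatrix}$ as in the context. Then the following relations hold between the Gray-Hervella classes of such structures (equality of classes meaning that such a structure belongs to one class if and only if it belongs to the other): - $\mathcal W_1=\{0\}$; - $\mathcal W_1\oplus\mathcal W_i=\mathcal W_i$ for $2\le i\le 4$; - $\mathcal W_1\oplus\mathcal W_2\oplus\mathcal W_4=\mathcal W_2\oplus\mathcal W_4$; - $\mathcal W_1\oplus\mathcal W_3\oplus\mathcal W_4=\mathcal W_3\oplus\mathcal W_4$. Moreover, $(J,\langle\cdot,\cdot\rangle)$ belongs to the given class if and only if the corresponding conditions hold: - $\{0\}$: $v_0=w_0=0$ and $D\in\mathfrak u(n-1)$; - $\mathcal W_2$: $v_0=0$ and $D\in\mathfrak{sp}(n-1,\mathbb R)$; - $\mathcal W_3$: $\operatorname{Tr}D=0$, $v_0=w_0=0$ and $D\in\mathfrak{gl}(n-1,\mathbb C)$; - $\mathcal W_4$: $v_0=w_0=0$ and $D-\frac{\operatorname{Tr}D}{2(n-1)}\mathrm I\in\mathfrak u(n-1)$; - $\mathcal W_2\oplus\mathcal W_3$: $\operatorname{Tr}D=0$, $v_0=0$ and $D\in\operatorname{Sym}(2n-2)\oplus\mathfrak u(n-1)$; - $\mathcal W_1\oplus\mathcal W_2\oplus\mathcal W_3$: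 $\operatorname{Tr}D=0$ and $v_0=0$; - $\mathcal W_2\oplus\mathcal W_4$: $v_0=0$ and $D-\frac{\operatorname{Tr}D}{2(n-1)}\mathrm I\in\mathfrak{sp}(n-1,\mathbb R)$; - $\mathcal W_3\oplus\mathcal W_4$: $w_0=0$ and $D\in\mathfrak{gl}(n-1,\mathbb C)$; - $\mathcal W_2\oplus\mathcal W_3\oplus\mathcal W_4$: $D\in\operatorname{Sym}(2n-2)\oplus\mathfrak u(n-1)$; - $\mathcal W$: no condition.
   Context: A Lie algebra $\mathfrak{g}$ is almost abelian if it has a codimension one abelian ideal $\mathfrak{u}$. An almost Hermitian structure on a real Lie algebra $\mathfrak g$ is a pair $(J,\langle\cdot,\cdot\rangle)$ with $\langle\cdot,\cdot\rangle$ an inner product and $J:\mathfrak{g}\to\mathfrak{g}$ an endomorphism with $J^2=-\mathrm{I}$ and $\langle J\cdot,J\cdot\rangle=\langle\cdot,\cdot\rangle$ (equivalently, a left invariant almost Hermitian structure on the simply connected Lie group with Lie algebra $\mathfrak g$). Matrix notation: fix a codimension one abelian ideal $\mathfrak u$ and a unit vector $e_0$ orthogonal to $\mathfrak u$, and let $L=\operatorname{ad}_{e_0}|_{\mathfrak u}$, so $\mathfrak g=\mathbb{R}e_0\ltimes_L\mathfrak u$, $\mathfrak u\cong\mathbb{R}^{2n-1}$. Put $e_1=Je_0\in\mathfrak u$, $\mathfrak a=\mathfrak u\cap J\mathfrak u$ (of dimension $2n-2$, the orthogonal complement of $\mathrm{span}\{e_0,e_1\}$), $J'=J|_{\mathfrak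 a}$. With respect to $\mathfrak u=\mathbb{R}e_1\oplus\mathfrak a$ write $L=\begin{bmatrix}\mu & w_0^t\\ v_0 & D\end{bmatrix}$ with $\mu\in\mathbb R$, $v_0,w_0\in\mathfrak a$, $D\in\mathfrak{gl}(\mathfrak a)$, that is, $Le_1=\mu e_1+v_0$ and $Lx=\langle w_0,x\rangle e_1+Dx$ for $x\in\mathfrak a$. Subspaces of $\mathfrak{gl}(\mathfrak a)$, with $X^t$ the adjoint with respect to $\langle\cdot,\cdot\rangle$: $\mathfrak{gl}(n-1,\mathbb C)=\{X: [X,J']=0\}$; $\mathfrak u(n-1)=\{X:[X,J']=0,\ X^t=-X\}$; $\mathfrak{sp}(n-1,\mathbb R)=\{X: X^tJ'+J'X=0\}$; $\operatorname{Sym}(2n-2)=\{X:X^t=X\}$. Tensors (all $x,y,z,\dots\in\mathfrak g$): $\nabla$ is the Levi-Civita connection, $2\langle\nabla_xy,z\rangle=\langle[x,y],z\rangle-\langle[y,z],x\rangle+\langle[z,x],y\rangle$; $\omega(x,y)=\langle Jx,y\rangle$; $(\nabla_x\omega)(y,z)=-\omega(\nabla_xy,z)-\omega(y,\nabla_xz)$; $d\omega(x,y,z)=-\omega([x,y],z)-\omega([y,z],x)-\omega([z,x],y)$; $\delta\omega(x)=-\sum_i(\nabla_{f_i}\omega)(f_i,x)$ for an orthonormal basis $\{f_i\}$; Lee form $\theta(x)=-\frac1{n-1}\delta\omega(Jx)$; $(\theta\wedge\omega)(x,y,z)=\theta(x)\omega(y,z)+\theta(y)\omega(z,x)+\theta(z)\omega(x,y)$;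 $N(x,y)=[x,y]+J([Jx,y]+[x,Jy])-[Jx,Jy]$; $T^{\pm}(x,y,z)=(\nabla_x\omega)(y,z)\pm(\nabla_{Jx}\omega)(Jy,z)$; $U(x,y,z)=\langle x,y\rangle\delta\omega(z)-\langle x,z\rangle\delta\omega(y)-\langle x,Jy\rangle\delta\omega(Jz)+\langle x,Jz\rangle\delta\omega(Jy)$. $\sum_{cyc}$ denotes the cyclic sum over $(x,y,z)$. Gray-Hervella classes in dimension $2n\ge 6$ (conditions required for all $x,y,z$): $\{0\}$: $\nabla\omega=0$; $\mathcal W_1$: $3\nabla\omega=d\omega$; $\mathcal W_2$: $d\omega=0$; $\mathcal W_3$: $\delta\omega=0$ and $N=0$; $\mathcal W_4$: $(\nabla_x\omega)(y,z)=-\frac1{2(n-1)}U(x,y,z)$; $\mathcal W_1\oplus\mathcal W_2$: $T^+=0$; $\mathcal W_3\oplus\mathcal W_4$: $N=0$; $\mathcal W_1\oplus\mathcal W_3$: $T^-(x,x,y)=0$ and $\delta\omega=0$; $\mathcal W_2\oplus\mathcal W_4$: $d\omega=\theta\wedge\omega$; $\mathcal W_1\oplus\mathcal W_4$: $(\nabla_x\omega)(x,y)=-\frac1{2(n-1)}U(x,x,y)$; $\mathcal W_2\oplus\mathcal W_3$: $\sum_{cyc}T^-(x,y,z)=0$ and $\delta\omega=0$; $\mathcal W_1\oplus\mathcal W_2\oplus\mathcal W_3$: $\delta\omega=0$; $\mathcal W_1\oplus\mathcal W_2\oplus\mathcal W_4$: $T^+(x,y,z)=-\frac1{n-1}U(x,y,z)$;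 $\mathcal W_1\oplus\mathcal W_3\oplus\mathcal W_4$: $\langle N(x,y),x\rangle=0$; $\mathcal W_2\oplus\mathcal W_3\oplus\mathcal W_4$: $\sum_{cyc}T^-(x,y,z)=0$; $\mathcal W$: no condition. *)

(* Defs.v *)
From mathcomp Require Import all_boot all_order all_algebra.
From mathcomp Require Import reals.

Set Implicit Arguments.
Unset Strict Implicit.
Unset Printing Implicit Defensive.

Import Order.TTheory GRing.Theory Num.Theory.

Local Open Scope ring_scope.

Section LieAlgebra.
Variables (R : realType) (g : vectType R).

Definition lie_bracket (br : {bilinear g -> g -> g}) : Prop :=
  (forall x, br x x = 0) /\
  (forall x y z, br x (br y z) + br y (br z x) + br z (br x y) = 0).

Definition codim1_abelian_ideal (br : g -> g -> g) (u : {vspace g}) : Prop :=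
  [/\ (\dim u).+1 = \dim {:g},
      forall x y, y \in u -> br x y \in u
    & forall x y, x \in u -> y \in u -> br x y = 0].

Definition almost_hermitian (ip : g -> g -> R) (J : 'End(g)) : Prop :=
  (J \o J)%VF = - \1%VF /\ (forall x y, ip (J x) (J y) = ip x y).

Definition unit_normal (ip : g -> g -> R) (u : {vspace g}) (e0 : g) : Prop :=
  ip e0 e0 = 1 /\ (forall x, x \in u -> ip e0 x = 0).

(* The Koszul formula determines nabla, since ip is nondegenerate. *)
Definition levi_civita (br : g -> g -> g) (ip : g -> g -> R)
    (nabla : g -> g -> g) : Prop :=
  forall x y z,
    2 * ip (nabla x y) z = ip (br x y) z - ip (br y z) x + ip (br z x) y.

Definition orthonormal_basis (ip : g -> g -> R) (f : seq g) : Prop :=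
  basis_of fullv f /\
  (forall i j, (i < size f)%N -> (j < size f)%N -> ip f`_i f`_j = (i == j)%:R).

End LieAlgebra.

Section GrayHervella.
Variables (R : realType) (g : vectType R) (n : nat).
Variables (br : g -> g -> g) (ip : g -> g -> R) (J : 'End(g)).
Variables (nabla : g -> g -> g) (f : seq g).

Definition omega (x y : g) : R := ip (J x) y.

Definition nabla_omega (x y z : g) : R :=
  - omega (nabla x y) z - omega y (nabla x z).

Definition d_omega (x y z : g) : R :=
  - omega (br x y) z - omega (br y z) x - omega (br z x) y.

Definition delta_omega (x : g) : R := - \sum_(e <- f) nabla_omega e e x.

Definition lee_form (x : g) : R := - (n%:R - 1)^-1 * delta_omega (J x).

Definition lee_wedge_omega (x y z : g) : R :=
  lee_form x * omega y z + lee_form y * omega z x + lee_form z * omega x y.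

Definition nijenhuis (x y : g) : g :=
  br x y + J (br (J x) y + br x (J y)) - br (J x) (J y).

Definition T_plus (x y z : g) : R :=
  nabla_omega x y z + nabla_omega (J x) (J y) z.

Definition T_minus (x y z : g) : R :=
  nabla_omega x y z - nabla_omega (J x) (J y) z.

Definition U_tensor (x y z : g) : R :=
  ip x y * delta_omega z - ip x z * delta_omega y
  - ip x (J y) * delta_omega (J z) + ip x (J z) * delta_omega (J y).

Definition cyclic_sum (F : g -> g -> g -> R) (x y z : g) : R :=
  F x y z + F y z x + F z x y.

(* The digits of a constructor are the indices of the summands W_i. *)
Variant gh_class : Type :=
  | GH0
  | GH1 | GH2 | GH3 | GH4
  | GH12 | GH34 | GH13 | GH24 | GH14 | GH23
  | GH123 | GH124 | GH134 | GH234
  | GH1234.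

Definition gray_hervella (c : gh_class) : Prop :=
  match c with
  | GH0 => forall x y z, nabla_omega x y z = 0
  | GH1 => forall x y z, 3 * nabla_omega x y z = d_omega x y z
  | GH2 => forall x y z, d_omega x y z = 0
  | GH3 => (forall x, delta_omega x = 0) /\ (forall x y, nijenhuis x y = 0)
  | GH4 => forall x y z,
      nabla_omega x y z = - (2 * (n%:R - 1))^-1 * U_tensor x y z
  | GH12 => forall x y z, T_plus x y z = 0
  | GH34 => forall x y, nijenhuis x y = 0
  | GH13 => (forall x y, T_minus x x y = 0) /\ (forall x, delta_omega x = 0)
  | GH24 => forall x y z, d_omega x y z = lee_wedge_omega x y z
  | GH14 => forall x y,
      nabla_omega x x y = - (2 * (n%:R - 1))^-1 * U_tensor x x y
  | GH23 => (forall x y z, cyclic_sum T_minus x y z = 0) /\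
            (forall x, delta_omega x = 0)
  | GH123 => forall x, delta_omega x = 0
  | GH124 => forall x y z,
      T_plus x y z = - (n%:R - 1)^-1 * U_tensor x y z
  | GH134 => forall x y, ip (nijenhuis x y) x = 0
  | GH234 => forall x y z, cyclic_sum T_minus x y z = 0
  | GH1234 => True
  end.

End GrayHervella.

Section Endomorphisms.
Variables (R : realType) (V : vectType R).
Variables (q : V -> V -> R) (I : 'End(V)).
Implicit Types X Y S A : 'End(V).

Definition lftrace X : R := \tr (passmx.mxof (vbasis {:V}) (vbasis {:V}) X).

Definition is_adjoint X Y : Prop := forall x y, q (X x) y = q x (Y y).

Definition in_gl X : Prop := (X \o I)%VF = (I \o X)%VF.

Definition in_u X : Prop := in_gl X /\ is_adjoint X (- X).

Definition in_sp X : Prop :=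
  exists2 Y, is_adjoint X Y & (Y \o I)%VF + (I \o X)%VF = 0.

Definition in_sym X : Prop := is_adjoint X X.

(* The sum is direct: a self-adjoint and skew-adjoint X is 0. *)
Definition in_sym_plus_u X : Prop :=
  exists S A, [/\ in_sym S, in_u A & X = S + A].

End Endomorphisms.

Section BlockForm.
Variables (R : realType) (g : vectType R).
Variables (br : g -> g -> g) (ip : g -> g -> R) (J : 'End(g)).
Variable u : {vspace g}.

Definition cplx_part : {vspace g} := (u :&: (J @: u))%VS.

Definition ip_part (x y : subvs_of cplx_part) : R := ip (vsval x) (vsval y).

(* When J^2 = - 1, J preserves cplx_part and vsproj only retypes J x. *)
Definition J_part : 'End(subvs_of cplx_part) :=
  linfun (vsproj cplx_part \o J \o vsval).

(* [[mu, w0^t], [v0, D]] is the matrix of the restriction of ad e0 to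
   u = <[J e0]> + cplx_part. *)
Definition block_form (e0 : g) (mu : R) (v0 w0 : subvs_of cplx_part)
    (D : 'End(subvs_of cplx_part)) : Prop :=
  br e0 (J e0) = mu *: J e0 + vsval v0 /\
  (forall x : subvs_of cplx_part,
     br e0 (vsval x) = ip_part w0 x *: J e0 + vsval (D x)).

End BlockForm.

(* Main.v *)
(** Every vector is [t e0 + c e1 + y] with [e1 = J e0] and [y] in the maximal
J-invariant subspace [a] of [u]. The Koszul formula then expresses
[2 (nabla omega)] through four pieces only: the functionals [<v0 - w0, .>] and
[<v0 + w0, .>] and the bilinear forms of [D + D^t] and of
[[D - D^t, J']]; [mu] cancels. Likewise
[delta omega (t e0 + c e1 + y) = c Tr D - <v0, y>]. Each class condition is read
off from its values on [e0], [e1] and [a]; the converse is a polynomial identity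
in the coordinates. The dimension enters only through [W_4]: the condition on
[v0] has the form [v0 = v0 / (n - 1)], which forces [v0 = 0] because [n <> 2]. *)

Require Import Defs.
From HB Require Import structures.
From mathcomp Require Import all_boot all_order all_algebra.
From mathcomp Require Import reals ring lra.

Set Implicit Arguments.
Unset Strict Implicit.
Unset Printing Implicit Defensive.

Import Order.TTheory GRing.Theory Num.Theory.

Local Open Scope ring_scope.

(** * Inner products and orthonormal expansions *)

Section InnerProduct.
Variables (R : realType) (V : vectType R) (q : {dot V for idfun}).

Lemma ipC x y : q x y = q y x.
Proof. by rewrite hermC expr0 mul1r. Qed.

Lemma ipDl x y z : q (x + y) z = q x z + q y z.
Proof. by rewrite linearDl. Qed.

Lemma ipDr x y z : q x (y + z) = q x y + q x z.
Proof. by rewrite linearDr. Qed.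

Lemma ipZl a x y : q (a *: x) y = a * q x y.
Proof. by rewrite linearZl_LR. Qed.

Lemma ipZr a x y : q x (a *: y) = a * q x y.
Proof. by rewrite linearZr_LR. Qed.

Lemma ipNl x y : q (- x) y = - q x y.
Proof. by rewrite linearNl. Qed.

Lemma ipNr x y : q x (- y) = - q x y.
Proof. by rewrite linearNr. Qed.

Lemma ip0l x : q 0 x = 0.
Proof. by rewrite linear0l. Qed.

Lemma ip0r x : q x 0 = 0.
Proof. by rewrite linear0r. Qed.

Lemma ip_suml (I : Type) (r : seq I) F y :
  q (\sum_(i <- r) F i) y = \sum_(i <- r) q (F i) y.
Proof. by rewrite linear_sumlz. Qed.

Lemma ip_sumr (I : Type) (r : seq I) F x :
  q x (\sum_(i <- r) F i) = \sum_(i <- r) q x (F i).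
Proof. by rewrite linear_sumr. Qed.

Lemma ip_eq0 x : q x x = 0 -> x = 0.
Proof.
move=> x0; apply/eqP; apply: contraT => xN0.
by have := neq0_dnorm_gt0 (s := q) _ xN0; rewrite x0 ltxx.
Qed.

Lemma ip_inj x y : (forall z, q x z = q y z) -> x = y.
Proof.
move=> xy; apply/eqP; rewrite -subr_eq0; apply/eqP/ip_eq0.
by rewrite ipDl ipNl xy subrr.
Qed.

Lemma orthonormal_basis_expansion (f : seq V) x :
  orthonormal_basis q f -> x = \sum_(e <- f) q x e *: e.
Proof.
move=> [bf fo].
have xE : x = \sum_(i < size f) coord (in_tuple f) i x *: f`_i.
  by apply: coord_span; rewrite (span_basis bf) memvf.
rewrite (big_nth 0) big_mkord [LHS]xE; apply: eq_bigr => i _; congr (_ *: _).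
rewrite [in RHS]xE ip_suml (bigD1 i)//= ipZl fo// eqxx mulr1 big1 ?addr0//.
by move=> j ji; rewrite ipZl fo// val_eqE (negPf ji) mulr0.
Qed.

End InnerProduct.

(** * Traces and adjoints computed in a Parseval frame *)

Section Frame.
Variables (R : realType) (V : vectType R) (q : {dot V for idfun}).
Variables (T : Type) (s : seq T) (h : T -> V).
(** The vectors [h e] need not form a basis. In the application [s] is an orthonormal basis of [g]
    and [h] takes the component in [V], so the family is redundant. *)
Hypothesis frame : forall x, x = \sum_(e <- s) q x (h e) *: h e.
Implicit Type X : 'End(V).

Lemma lftraceE X :
  lftrace X = \sum_i coord (vbasis {:V}) i (X (vbasis {:V})`_i).
Proof.
apply: eq_bigr => i _; rewrite /passmx.mxof /passmx.rVof /passmx.vecof !mxE/=.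
congr (coord _ i (X _)).
under eq_bigr => j _ do rewrite mxE eqxx /=.
by rewrite (bigD1 i)//= eqxx scale1r big1 ?addr0// => j /negPf->; rewrite scale0r.
Qed.

(** Expand the image of each basis vector in the frame and exchange the two sums: the sum over the
    basis then reassembles [X (h e)], whether or not the frame is redundant. *)
Lemma lftrace_frame X : lftrace X = \sum_(e <- s) q (X (h e)) (h e).
Proof.
rewrite lftraceE.
under eq_bigr => i _ do rewrite [X in coord _ _ X]frame linear_sum.
rewrite exchange_big/=; apply: eq_bigr => e _.
have hE : X (h e) = \sum_i coord (vbasis {:V}) i (h e) *: X (vbasis {:V})`_i.
  rewrite [in LHS](coord_vbasis (memvf (h e))) linear_sum.
  by apply: eq_bigr => i _; rewrite linearZ.
rewrite [in RHS]hE ip_suml; apply: eq_bigr => i _.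
by rewrite linearZ/= ipZl mulrC.
Qed.

Lemma lftrace_compC X Y : lftrace (X \o Y)%VF = lftrace (Y \o X)%VF.
Proof.
have b := vbasisP {:V}.
by rewrite /lftrace !(passmx.mxof_comp _ _ b) mxtrace_mulC.
Qed.

Fact adjoint_fun_is_linear X :
  linear (fun y => \sum_(e <- s) q (X (h e)) y *: h e).
Proof.
move=> a y z; rewrite scaler_sumr -big_split/=; apply: eq_bigr => e _.
by rewrite ipDr ipZr scalerDl scalerA.
Qed.

Lemma frame_adjoint X : exists Y : 'End(V), is_adjoint q X Y.
Proof.
pose G := HB.pack_for {linear V -> V}
  (fun y => \sum_(e <- s) q (X (h e)) y *: h e)
  (GRing.isLinear.Build _ _ _ _ _ (adjoint_fun_is_linear X)).
exists (linfun G) => x y; rewrite lfunE /= [in LHS](frame x) linear_sum.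
rewrite ip_suml ip_sumr; apply: eq_bigr => e _.
by rewrite linearZ/= ipZl ipZr mulrC.
Qed.

End Frame.

(** * The inner product induced on the complex part *)

Section PartInnerProduct.
Variables (R : realType) (g : vectType R) (ip : {dot g for idfun}).
Variables (J : 'End(g)) (u : {vspace g}).
Local Notation q := (@ip_part R g ip J u).

Fact ip_part_bilinear :
  bilinear_for ( *%R : R -> R -> R) (idfun \; *%R : R -> R -> R) q.
Proof.
split=> x a y z; rewrite /ip_part.
  by rewrite (linearP vsval)/= ipDl ipZl.
by rewrite (linearP vsval)/= ipDr ipZr.
Qed.

HB.instance Definition _ := bilinear_isBilinear.Build R _ _ _ _ _ q ip_part_bilinear.

Fact ip_part_herm x y : q x y = (-1) ^+ false * idfun (q y x).
Proof. by rewrite expr0 mul1r /ip_part ipC. Qed.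

HB.instance Definition _ := isHermitianSesquilinear.Build R _ false idfun q ip_part_herm.

Fact ip_part_pos x : x != 0 -> 0 < q x x.
Proof.
move=> x0; apply: neq0_dnorm_gt0; apply: contra x0 => /eqP x0.
by apply/eqP/val_inj; rewrite linear0.
Qed.

HB.instance Definition _ := isDotProduct.Build R _ q ip_part_pos.
End PartInnerProduct.

(** * Coordinates [t e0 + c e1 + x] and the tensors expressed in them *)

Definition vec (R : realType) (g V : vectType R) (e0 e1 : g)
    (inj : {linear V -> g}) (t c : R) (x : V) : g :=
  t *: e0 + c *: e1 + inj x.

Section UnitaryFrame.
Variables (R : realType) (g V : vectType R).
Variables (ip : g -> g -> R) (br : g -> g -> g) (J : 'End(g)).
Variables (q : {dot V for idfun}) (I : 'End(V)).
Variables (e0 e1 : g) (inj : {linear V -> g}).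
Variables (mu : R) (v0 w0 : V) (D : 'End(V)).

Local Notation vec := (vec e0 e1 inj).

Variables (tc cc : g -> R) (pr : g -> V).
(** The complex part is an abstract space [V], and [ip] and [br] are bare functions known only
    through these formulas. The computations thus never meet subspaces or the Lie algebra axioms. *)
Hypothesis vecE : forall X, X = vec (tc X) (cc X) (pr X).
Hypothesis ipE : forall t c x t' c' x',
  ip (vec t c x) (vec t' c' x') = t * t' + c * c' + q x x'.
Hypothesis JE : forall t c x, J (vec t c x) = vec (- c) t (I x).
Hypothesis brE : forall t c x t' c' x',
  br (vec t c x) (vec t' c' x') =
  vec 0 (t * (mu * c' + q w0 x') - t' * (mu * c + q w0 x))
    (t *: (c' *: v0 + D x') - t' *: (c *: v0 + D x)).
Hypothesis II : forall x, I (I x) = - x.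
Hypothesis qII : forall x y, q (I x) (I y) = q x y.

Lemma vecP X : exists t c x, X = vec t c x.
Proof. by exists (tc X), (cc X), (pr X); apply: vecE. Qed.

Lemma qIl x y : q (I x) y = - q x (I y).
Proof. by rewrite -[in RHS]qII II ipNr opprK. Qed.

Let LD (X : 'End(V)) x y : X (x + y) = X x + X y. Proof. exact: linearD. Qed.
Let LZ (X : 'End(V)) a x : X (a *: x) = a *: X x. Proof. exact: linearZ. Qed.
Let LN (X : 'End(V)) x : X (- x) = - X x. Proof. exact: linearN. Qed.
Let L0 (X : 'End(V)) : X 0 = 0. Proof. exact: linear0. Qed.

Let qE := (LD, LZ, LN, L0,
  (ipDl, ipDr, ipZl, ipZr, ipNl, ipNr, ip0l, ip0r), qII, II).

Lemma vecD t c x t' c' x' :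
  vec t c x + vec t' c' x' = vec (t + t') (c + c') (x + x').
Proof.
rewrite /vec linearD !scalerDl [LHS]addrACA; congr (_ + _); exact: addrACA.
Qed.

Lemma vecN t c x : - vec t c x = vec (- t) (- c) (- x).
Proof. by rewrite /vec linearN !opprD !scaleNr. Qed.

Variable nabla : g -> g -> g.
Hypothesis nablaE : levi_civita br ip nabla.

Lemma ip_JC X Y : ip (J X) Y = - ip X (J Y).
Proof.
have [t [c [x ->]]] := vecP X; have [t' [c' [y ->]]] := vecP Y.
rewrite !JE !ipE qIl; ring.
Qed.

Local Notation N := (nabla_omega ip J nabla).

(* [<[D - D^t, I] y, z>] *)
Definition comm_form y z :=
  q (D y) (I z) - q (D (I z)) y - q (D z) (I y) + q (D (I y)) z.

Definition sym_form x y := q (D x) y + q (D y) x.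

Lemma nabla_omegaE t1 c1 x t2 c2 y t3 c3 z :
  N (vec t1 c1 x) (vec t2 c2 y) (vec t3 c3 z) = 2^-1 *
  (t1 * (comm_form y z + t2 * q (v0 - w0) z + c2 * q (v0 - w0) (I z)
         - t3 * q (v0 - w0) y - c3 * q (v0 - w0) (I y))
   + c1 * (- t2 * q (v0 + w0) (I z) + c2 * q (v0 + w0) z
           + t3 * q (v0 + w0) (I y) - c3 * q (v0 + w0) y)
   - t2 * sym_form x (I z) + c2 * sym_form x z
   + t3 * sym_form x (I y) - c3 * sym_form x y).
Proof.
apply: (canRL (mulKf _)); first by rewrite pnatr_eq0.
have ip_sym X Y : ip X Y = ip Y X.
  have [t [c [x' ->]]] := vecP X; have [t' [c' [y' ->]]] := vecP Y.
  rewrite !ipE ipC; ring.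
(* The Koszul formula needs [nabla] in the first argument of [ip], so [J] is moved off it in one
   term and symmetry is used in the other. *)
rewrite /nabla_omega /omega ip_JC opprK (ip_sym (J _)) mulrBr.
rewrite !JE !nablaE !brE !ipE /comm_form /sym_form !qE; ring.
Qed.

(** [mu] and [w0] enter only the [e1]-component of a bracket, which [omega] pairs with the
    [e0]-coordinate of the remaining argument; these terms cancel in the cyclic sum. *)
Lemma d_omegaE t1 c1 x t2 c2 y t3 c3 z :
  d_omega br ip J (vec t1 c1 x) (vec t2 c2 y) (vec t3 c3 z) =
  t1 * (q (D y) (I z) - q (D z) (I y)) + (t1 * c2 - c1 * t2) * q v0 (I z)
  + t2 * (q (D z) (I x) - q (D x) (I z)) + (t2 * c3 - c2 * t3) * q v0 (I x)
  + t3 * (q (D x) (I y) - q (D y) (I x)) + (t3 * c1 - c3 * t1) * q v0 (I y).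
Proof.
rewrite /d_omega /omega !ip_JC !JE !brE !ipE !qE; ring.
Qed.

(** [mu] and [v0] enter only through the bracket of [e0] and [e1 = J e0]; they drop out because
    [N(X, J X) = 0] for every [X]. *)
Lemma nijenhuisE t1 c1 x t2 c2 y :
  nijenhuis br J (vec t1 c1 x) (vec t2 c2 y) =
  vec (c1 * q w0 y - t1 * q w0 (I y) - c2 * q w0 x + t2 * q w0 (I x))
      (t1 * q w0 y + c1 * q w0 (I y) - t2 * q w0 x - c2 * q w0 (I x))
      (t1 *: (D y + I (D (I y))) + c1 *: (D (I y) - I (D y))
       - t2 *: (D x + I (D (I x))) - c2 *: (D (I x) - I (D x))).
Proof.
rewrite /nijenhuis !JE !brE vecD JE vecN !vecD.
congr vec; rewrite ?qE; [ring | ring |].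
apply: (@ip_inj _ _ q) => z; rewrite !qE; ring.
Qed.

(** * The codifferential of [omega] *)

Variable f : seq g.
Hypothesis parseval : forall X Y, ip X Y = \sum_(e <- f) ip X e * ip e Y.

(** A vector of [V] pairs with [e] only through [pr e], so Parseval for [f] restricts to [V]. *)
Lemma frame_pr x : x = \sum_(e <- f) q x (pr e) *: pr e.
Proof.
apply: (@ip_inj _ _ q) => y; rewrite ip_suml.
have := parseval (vec 0 0 x) (vec 0 0 y).
rewrite ipE !mul0r !add0r => ->; apply: eq_bigr => e _.
by rewrite [in LHS](vecE e) !ipE !mul0r !mulr0 !add0r ipZl.
Qed.

Lemma delta_omegaE t c z :
  delta_omega ip J nabla f (vec t c z) = c * lftrace D - q v0 z.
Proof.
have [Dt DtE] := frame_adjoint frame_pr D.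
(* This is Parseval for two vectors given by coordinates. Setting the coordinates to 0 or 1 yields
   the sums of products of [tc], [cc] and [pr] below. *)
have ortho s1 s2 a b x y :
    \sum_(e <- f) (s1 * tc e + s2 * cc e + q x (pr e))
      * (a * tc e + b * cc e + q y (pr e))
    = s1 * a + s2 * b + q x y.
  have := parseval (vec s1 s2 x) (vec a b y); rewrite ipE => ->.
  apply: eq_bigr => e _; rewrite [e in RHS]vecE !ipE (ipC q y); ring.
have sum_tt : \sum_(e <- f) tc e * tc e = 1.
  transitivity (1 * 1 + 0 * 0 + q 0 0); last by rewrite ip0l; ring.
  by rewrite -ortho; apply: eq_bigr => e _; rewrite !ip0l; ring.
have sum_cc : \sum_(e <- f) cc e * cc e = 1.
  transitivity (0 * 0 + 1 * 1 + q 0 0); last by rewrite ip0l; ring.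
  by rewrite -ortho; apply: eq_bigr => e _; rewrite !ip0l; ring.
have sum_tc : \sum_(e <- f) tc e * cc e = 0.
  transitivity (1 * 0 + 0 * 1 + q 0 0); last by rewrite ip0l; ring.
  by rewrite -ortho; apply: eq_bigr => e _; rewrite !ip0l; ring.
have sum_tq a : \sum_(e <- f) tc e * q (pr e) a = 0.
  transitivity (1 * 0 + 0 * 0 + q 0 a); last by rewrite ip0l; ring.
  by rewrite -ortho; apply: eq_bigr => e _; rewrite !ip0l (ipC q a); ring.
have sum_cq a : \sum_(e <- f) cc e * q (pr e) a = 0.
  transitivity (0 * 0 + 1 * 0 + q 0 a); last by rewrite ip0l; ring.
  by rewrite -ortho; apply: eq_bigr => e _; rewrite !ip0l (ipC q a); ring.
(* Moving [I] across [q] turns the sum into the trace of [D I] minus that of [I D]. *)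
have sum_symI : \sum_(e <- f) sym_form (pr e) (I (pr e)) = 0.
  rewrite -[RHS](subrr (lftrace (D \o I)%VF)) [X in _ = _ - X]lftrace_compC.
  rewrite !(lftrace_frame frame_pr) -sumrB; apply: eq_bigr => e _.
  by rewrite !comp_lfunE qIl /sym_form; ring.
have sum_sym : \sum_(e <- f) sym_form (pr e) (pr e) = 2 * lftrace D.
  rewrite (lftrace_frame frame_pr) mulr_sumr; apply: eq_bigr => e _.
  by rewrite /sym_form; ring.
(* [a] and [b] represent, as inner products, the terms that are linear in [pr e];
   weighted by [tc e] and [cc e], these sum to 0 by orthogonality. *)
pose a := Dt (I z) - D (I z) + I (D z) - I (Dt z) - t *: (v0 - w0)
  + c *: I (v0 - w0) - Dt (I z) - D (I z).
pose b := Dt z + D z - t *: I (v0 + w0) - c *: (v0 + w0).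
have NE e : 2 * N e e (vec t c z) =
    tc e * q (pr e) a + cc e * q (pr e) b
    + q (v0 - w0) z * (tc e * tc e) + q (v0 + w0) z * (cc e * cc e)
    - 2 * q w0 (I z) * (tc e * cc e)
    + t * sym_form (pr e) (I (pr e)) - c * sym_form (pr e) (pr e).
  rewrite [e in LHS]vecE nabla_omegaE mulVKf ?pnatr_eq0// /comm_form /sym_form /a /b.
  set x := pr e; rewrite !qE !(ipC q _ x) !(ipC q _ (I x)) !qIl.
  rewrite !DtE !qIl; ring.
apply: (@mulfI _ 2); first by rewrite pnatr_eq0.
rewrite /delta_omega mulrN mulr_sumr (eq_bigr _ (fun e _ => NE e)).
rewrite !big_split/= -!mulr_sumr !sumrN -!mulr_sumr.
rewrite sum_tq sum_cq sum_tt sum_cc sum_tc sum_sym sum_symI !qE.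
ring.
Qed.

(** * Coordinate conditions for the Gray-Hervella classes *)

Variable n : nat.
Hypothesis n_ge3 : (3 <= n)%N.
Local Notation W := (gray_hervella n br ip J nabla f).
Local Notation E0 := (vec 1 0 0).
Local Notation E1 := (vec 0 1 0).
Local Notation A x := (vec 0 0 x).
Local Notation tr := (lftrace D).

(* [tau = tr / (2 * m)] *)
Variables m tau : R.
Hypotheses (mE : m = n%:R - 1) (tauE : forall c, m^-1 * (c * tr) = 2 * tau * c).

Let m_ge2 : 2 <= m.
Proof. by have : 3%:R <= n%:R :> R by [rewrite ler_nat]; rewrite mE; lra. Qed.

(** Multiplying by [m] gives [(m - 1) * a = 0], and [m >= 2]. *)
Lemma lee_scaled_eq0 a : a = m^-1 * a -> a = 0.
Proof.
have m0 : m != 0 by apply/eqP; move: m_ge2; lra.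
move=> /(congr1 ( *%R m)); rewrite mulVKf// => am.
by apply/eqP; have : (m - 1) * a == 0 by [apply/eqP; lra];
  rewrite mulf_eq0 => /orP[/eqP|//]; move: m_ge2; lra.
Qed.

(** The trace is absorbed into [tau], so that in the classes containing W4 the factor [m^-1]
    survives only in front of [q v0 z] and disappears once [v0 = 0]. *)
Lemma scaled_deltaE t c z :
  m^-1 * delta_omega ip J nabla f (vec t c z) = 2 * tau * c - m^-1 * q v0 z.
Proof.
by rewrite delta_omegaE mulrBr tauE.
Qed.

Lemma scaled_U_tensorE X Y Z : m^-1 * U_tensor ip J nabla f X Y Z =
  ip X Y * (m^-1 * delta_omega ip J nabla f Z)
  - ip X Z * (m^-1 * delta_omega ip J nabla f Y)
  - ip X (J Y) * (m^-1 * delta_omega ip J nabla f (J Z))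
  + ip X (J Z) * (m^-1 * delta_omega ip J nabla f (J Y)).
Proof. by rewrite /U_tensor; ring. Qed.

Lemma q_eq0 a : (forall z, q a z = 0) -> a = 0.
Proof. by move=> a0; apply: (@ip_eq0 _ _ q). Qed.

Lemma qIC x y : q y (I x) = - q x (I y).
Proof. by rewrite ipC qIl. Qed.

(** Normal form in which [I] stands only in the second argument of [q] or under [D], so that [lra]
    and [ring] recognize equal terms. *)
Ltac expand := rewrite ?(nabla_omegaE, d_omegaE, JE, ipE, brE)
  /comm_form /sym_form ?qE ?qIl ?qE.

(** These are the matrix conditions tested against [q], with no adjoint in sight: [D] in gl, [D - s]
    in u, [D - s] in sp, [D] in Sym + u. The last one holds exactly when the skew part of [D]
    commutes with [I]. *)
Definition gl_cond := forall x y, q (D (I x)) y = - q (D x) (I y).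
Definition u_cond s := gl_cond /\ forall x y, q (D y) x = 2 * s * q x y - q (D x) y.
Definition sp_cond s := forall x y, q (D x) (I y) = q (D y) (I x) + 2 * s * q x (I y).
Definition sym_u_cond := forall x y, comm_form x y = 0.

(** The condition says that the symmetric part of [D] is the scalar [s], which commutes with [I],
    and that the skew part commutes with [I]. In this form it can be read off from
    [nabla_omegaE]. *)
Lemma u_condP s :
  u_cond s <-> sym_u_cond /\ forall x y, sym_form x y = 2 * s * q x y.
Proof.
split=> [[gl sk]|[cm sy]]; split=> x y.
- by rewrite /comm_form !gl; lra.
- by rewrite /sym_form (sk x y); lra.
- have := cm x y; have := sy (I x) y; have := sy x (I y).
  by rewrite /comm_form /sym_form qIl; lra.
- by have := sy x y; rewrite /sym_form; lra.
Qed.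

Lemma u_sp_cond s : u_cond s -> sp_cond s.
Proof. by move=> [gl sk] x y; rewrite (sk (I y)) gl ipC; lra. Qed.

Lemma delta_omega_eq0P :
  (forall X, delta_omega ip J nabla f X = 0) <-> tr = 0 /\ v0 = 0.
Proof.
split=> [H|[t0 v] X].
  split; first by have := H E1; rewrite delta_omegaE ip0r; lra.
  by apply: q_eq0 => z; have := H (A z); rewrite delta_omegaE; lra.
by have [t [c [x ->]]] := vecP X; rewrite delta_omegaE t0 v ip0l; ring.
Qed.

(** The arguments [(e0, e0, z)], [(e1, e1, z)], [(e0, x, y)] and [(x, e1, y)] isolate, up to the
    factor 1/2, [v0 - w0], [v0 + w0], [comm_form] and [sym_form]. *)
Lemma GH0P : W GH0 <-> [/\ v0 = 0, w0 = 0 & u_cond 0].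
Proof.
split=> [H|[v w [gl sk]] X Y Z].
  have vw z : q (v0 - w0) z = 0 by have := H E0 E0 (A z); expand; lra.
  have vw' z : q (v0 + w0) z = 0 by have := H E1 E1 (A z); expand; lra.
  split.
  - by apply: q_eq0 => z; have := vw z; have := vw' z; rewrite !qE; lra.
  - by apply: q_eq0 => z; have := vw z; have := vw' z; rewrite !qE; lra.
  apply/u_condP; split=> x y.
    by have := H E0 (A x) (A y); expand; lra.
  by have := H (A x) E1 (A y); expand; lra.
have [t1 [c1 [x ->]]] := vecP X; have [t2 [c2 [y ->]]] := vecP Y.
have [t3 [c3 [z ->]]] := vecP Z.
expand; rewrite v w !qE.
ring: (gl x y) (gl x z) (gl y z) (gl y x) (gl z x) (gl z y) (sk x y) (sk x z)
  (sk y z) (sk (I x) y) (sk (I x) z) (sk (I y) z).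
Qed.

Lemma GH2_of_cond : v0 = 0 -> sp_cond 0 -> W GH2.
Proof.
move=> v sp X Y Z.
have [t1 [c1 [x ->]]] := vecP X; have [t2 [c2 [y ->]]] := vecP Y.
have [t3 [c3 [z ->]]] := vecP Z.
expand; rewrite v !qE.
ring: (sp x y) (sp x z) (sp y z).
Qed.

Lemma GH2P : W GH2 <-> v0 = 0 /\ sp_cond 0.
Proof.
split=> [H|[v sp]]; last exact: GH2_of_cond.
split; first by apply: q_eq0 => z; have := H E0 E1 (A (I z)); expand; lra.
by move=> y z; have := H E0 (A y) (A z); expand; lra.
Qed.

Lemma GH1P : W GH1 <-> [/\ v0 = 0, w0 = 0 & u_cond 0].
Proof.
split=> [H|cond X Y Z]; last first.
  have [v w u] := cond.
  rewrite (GH0P.2 cond) (GH2_of_cond v (u_sp_cond u)); ring.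
have vw z : q (v0 - w0) z = 0 by have := H E0 E0 (A z); expand; lra.
have vw' z : q (v0 + w0) z = 0 by have := H E1 E1 (A z); expand; lra.
(* [d_omega] vanishes on [(x, x, e1)], which kills [sym_form x x]; polarization gives the rest. *)
have sy x y : sym_form x y = 0.
  have := H (A x) (A x) E1; have := H (A y) (A y) E1.
  by have := H (A (x + y)) (A (x + y)) E1; expand; lra.
split.
- by apply: q_eq0 => z; have := vw z; have := vw' z; rewrite !qE; lra.
- by apply: q_eq0 => z; have := vw z; have := vw' z; rewrite !qE; lra.
apply/u_condP; split=> x y; last by rewrite sy; lra.
(* [nabla_omega] at [(x, e0, y)] is a multiple of [sym_form x (I y) = 0], so [d_omega] vanishes
   there, hence also at [(e0, x, y)] by skewness; this kills [comm_form]. *)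
have := H E0 (A x) (A y); have := H (A x) E0 (A y); have := sy x (I y).
by expand; lra.
Qed.

Lemma T_plus_eqP :
  (forall X Y Z, T_plus ip J nabla X Y Z = 0) <-> v0 = 0 /\ sp_cond 0.
Proof.
split=> [H|[v sp] X Y Z].
  (* [T_plus] at [(e0, e0, z)] adds the values at [(e0, e0, z)] and [(e1, e1, z)]: [w0] cancels and
     [v0] remains. *)
  split; first by apply: q_eq0 => z; have := H E0 E0 (A z); rewrite /T_plus; expand; lra.
  move=> y z; have := H E0 (A y) (A z); have := H (A y) E0 (A z).
  by rewrite /T_plus; expand; lra.
have [t1 [c1 [x ->]]] := vecP X; have [t2 [c2 [y ->]]] := vecP Y.
have [t3 [c3 [z ->]]] := vecP Z.
(* Instances of [sp] at [I]-images, each solved for one term so that [ring] can rewrite with it. *)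
have sp' x' y' : q (D (I y')) (I x') = - q (D x') y'.
  by have := sp x' (I y'); rewrite !qE; lra.
have sp'' x' y' : q (D (I x')) y' = q (D (I y')) x'.
  by have := sp (I x') (I y'); rewrite !qE; lra.
rewrite /T_plus; expand; rewrite v !qE.
ring: (sp x y) (sp x z) (sp y z) (sp' x y) (sp' y x) (sp' x z) (sp' z x)
  (sp' y z) (sp' z y) (sp'' x y) (sp'' x z) (sp'' y z).
Qed.

Lemma vec0 : vec 0 0 0 = 0.
Proof. by rewrite /vec linear0 !scale0r !addr0. Qed.

Lemma GH34_of_cond : w0 = 0 -> gl_cond -> W GH34.
Proof.
move=> w gl X Y; have [t1 [c1 [x ->]]] := vecP X.
have [t2 [c2 [y ->]]] := vecP Y.
have DI x' : D (I x') = I (D x') by apply: (@ip_inj _ _ q) => z; rewrite gl qIl.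
rewrite nijenhuisE -[RHS]vec0 w !DI; congr vec; rewrite ?ip0l; [ring|ring|].
by apply: (@ip_inj _ _ q) => z; rewrite !qE; ring.
Qed.

Lemma ip_0l X : ip 0 X = 0.
Proof. by have [t [c [x ->]]] := vecP X; rewrite -vec0 ipE ip0l; ring. Qed.

Lemma GH134P : W GH134 <-> w0 = 0 /\ gl_cond.
Proof.
split=> [H|[w gl] X Y]; last by rewrite (GH34_of_cond w gl) ip_0l.
have w z : q w0 z = 0.
  by have := H E0 (A (I z)); rewrite nijenhuisE ipE !qE; lra.
split; first exact: q_eq0.
(* Polarization by [e0 + I y]: the Nijenhuis tensor vanishes on pairs from [V], so its value at
   [(e0, x)] gets tested against [I y]. *)
move=> x y; have := H (vec 1 0 (I y)) (A x).
by rewrite nijenhuisE ipE !qE ?qIl !w; lra.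
Qed.

Lemma GH34P : W GH34 <-> w0 = 0 /\ gl_cond.
Proof.
split=> [H|[w gl]]; last exact: GH34_of_cond.
by apply/GH134P => X Y; rewrite H ip_0l.
Qed.

Lemma GH3P : W GH3 <-> [/\ tr = 0, v0 = 0, w0 = 0 & gl_cond].
Proof.
split=> [[/delta_omega_eq0P[? ?] /GH34P[? ?]]|[t0 v w gl]]; first by split.
by split; [exact/delta_omega_eq0P | exact/GH34P].
Qed.

Lemma GH13P : W GH13 <-> [/\ tr = 0, v0 = 0, w0 = 0 & gl_cond].
Proof.
split=> [[H /delta_omega_eq0P[t0 v]]|[t0 v w gl]].
  (* In [T_minus] at [(e0, e0, z)] it is [v0] that cancels. *)
  have w z : q w0 z = 0 by have := H E0 (A z); rewrite /T_minus; expand; lra.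
  have w00 := q_eq0 w.
  split=> // x y.
  (* The condition is quadratic in its first argument; adding [e0] to it produces the mixed terms,
     which carry [comm_form]. *)
  have := H (vec 1 0 x) (A y); have := H (vec 1 0 y) (A x).
  by rewrite /T_minus; expand; rewrite v w00 !qE; lra.
split; last exact/delta_omega_eq0P.
move=> X Y; have [t1 [c1 [x ->]]] := vecP X; have [t2 [c2 [y ->]]] := vecP Y.
have gl' x' y' : q (D (I x')) (I y') = q (D x') y' by rewrite gl !qE opprK.
rewrite /T_minus; expand; rewrite v w !qE.
ring: (gl x y) (gl y x) (gl x x) (gl' x y) (gl' y x) (gl' x x).
Qed.

Lemma half_scaled_UE X Y Z : - (2 * (n%:R - 1))^-1 * U_tensor ip J nabla f X Y Z =
  - 2^-1 * (m^-1 * U_tensor ip J nabla f X Y Z).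
Proof. by rewrite -mE invfM; ring. Qed.

Ltac expandU := rewrite ?half_scaled_UE -?mE ?mulNr ?scaled_U_tensorE ?JE ?scaled_deltaE;
  expand.

(** The W4 condition restricts to the W1 + W4 one on equal arguments, so this single implication
    serves both classes and makes them coincide. *)
Lemma GH14_cond : W GH14 -> [/\ v0 = 0, w0 = 0 & u_cond tau].
Proof.
move=> H.
have vw z : q v0 z - q w0 z = m^-1 * q v0 z.
  by have := H E0 (A z); expandU; lra.
have vw' z : q v0 z + q w0 z = m^-1 * q v0 z.
  by have := H E1 (A z); expandU; lra.
have v : v0 = 0.
  (* Half the sum of [vw] and [vw'] is [v0 = m^-1 v0]. *)
  by apply: q_eq0 => z; apply: lee_scaled_eq0; have := vw z; have := vw' z; lra.
have w : w0 = 0.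
  by apply: q_eq0 => z; have := vw z; rewrite v !qE; lra.
have sy x y : sym_form x y = 2 * tau * q x y.
  have := H (A x) E1; have := H (A y) E1; have := H (A (x + y)) E1.
  by expandU; rewrite v !qE (ipC q y x); lra.
split=> //; apply/u_condP; split=> // y z.
have := H (vec 1 0 y) (A z); have := sy y (I z).
by expandU; rewrite v w !qE; lra.
Qed.

Lemma GH4P : W GH4 <-> [/\ v0 = 0, w0 = 0 & u_cond tau].
Proof.
split=> [H|[v w [gl sk]] X Y Z]; first by apply: GH14_cond => X Y; apply: H.
have [t1 [c1 [x ->]]] := vecP X; have [t2 [c2 [y ->]]] := vecP Y.
have [t3 [c3 [z ->]]] := vecP Z.
expandU; rewrite v w !qE.
have skI x' y' : q (D y') (I x') = q (D x') (I y') - 2 * tau * q x' (I y').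
  by have := sk (I x') y'; rewrite gl qIl; lra.
ring: (gl x y) (gl x z) (gl y z) (gl y x) (gl z x) (gl z y) (sk x y) (sk x z)
  (sk y z) (skI x y) (skI x z) (skI y z)
  (qIC x y) (qIC x z) (qIC y z) (ipC q y x) (ipC q z x) (ipC q z y).
Qed.

Lemma GH14P : W GH14 <-> [/\ v0 = 0, w0 = 0 & u_cond tau].
Proof. by split=> [|/GH4P H X Y]; [exact: GH14_cond | exact: H]. Qed.

Lemma scaled_lee_formE t c z : lee_form n ip J nabla f (vec t c z) =
  - (2 * tau * t - m^-1 * q v0 (I z)).
Proof. by rewrite /lee_form JE -mE mulNr scaled_deltaE. Qed.

Lemma GH24P : W GH24 <-> v0 = 0 /\ sp_cond tau.
Proof.
split=> [H|[v sp] X Y Z].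
  split.
    apply: q_eq0 => z; apply: lee_scaled_eq0; have := H E0 E1 (A (I z)).
    by rewrite /lee_wedge_omega /omega !scaled_lee_formE; expand; lra.
  move=> y z; have := H E0 (A y) (A z).
  by rewrite /lee_wedge_omega /omega !scaled_lee_formE; expand; lra.
have [t1 [c1 [x ->]]] := vecP X; have [t2 [c2 [y ->]]] := vecP Y.
have [t3 [c3 [z ->]]] := vecP Z.
rewrite /lee_wedge_omega /omega !scaled_lee_formE; expand; rewrite v !qE.
ring: (sp x y) (sp x z) (sp y z) (qIC x y) (qIC x z) (qIC y z).
Qed.

Lemma GH124P : W GH124 <-> v0 = 0 /\ sp_cond tau.
Proof.
split=> [H|[v sp] X Y Z].
  have v : v0 = 0.
    apply: q_eq0 => z; apply: lee_scaled_eq0; have := H E0 E0 (A z).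
    by rewrite /T_plus; expandU; lra.
  split=> // y z; have := H E0 (A y) (A z); have := H (A y) E0 (A z).
  by rewrite /T_plus; expandU; rewrite v !qE; lra.
have [t1 [c1 [x ->]]] := vecP X; have [t2 [c2 [y ->]]] := vecP Y.
have [t3 [c3 [z ->]]] := vecP Z.
have sp1 x' y' : q (D (I y')) (I x') = 2 * tau * q x' y' - q (D x') y'.
  by have := sp x' (I y'); rewrite !qE; lra.
have sp2 x' y' : q (D (I x')) (I y') = 2 * tau * q x' y' - q (D y') x'.
  by rewrite sp1 ipC.
have sp3 x' y' : q (D (I x')) y' = q (D (I y')) x' - 2 * tau * q x' (I y').
  by have := sp (I x') (I y'); rewrite !qE qIl; lra.
(* [mulr0] clears the terms in [m^-1], which vanish with [v0], before [field] is called. *)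
rewrite /T_plus; expandU; rewrite v !qE !mulr0.
by field: (sp x y) (sp x z) (sp y z) (sp1 x y) (sp1 x z) (sp1 y z) (sp2 x y)
  (sp2 x z) (sp2 y z) (sp3 x y) (sp3 x z) (sp3 y z).
Qed.

(** At [(e0, y, z)] the [sym_form] terms cancel in the cyclic sum and half of [comm_form y z]
    remains. *)
Lemma GH234P : W GH234 <-> sym_u_cond.
Proof.
split=> [H y z|cm X Y Z].
  have := H E0 (A y) (A z).
  by rewrite /cyclic_sum /T_minus; expand; lra.
have [t1 [c1 [x ->]]] := vecP X; have [t2 [c2 [y ->]]] := vecP Y.
have [t3 [c3 [z ->]]] := vecP Z.
have cm1 x' y' : q (D x') (I y') = q (D (I y')) x' + q (D y') (I x') - q (D (I x')) y'.
  by have := cm x' y'; rewrite /comm_form; lra.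
have cm2 x' y' : q (D (I x')) (I y') = q (D (I y')) (I x') - q (D y') x' + q (D x') y'.
  by have := cm (I x') y'; rewrite /comm_form !qE; lra.
rewrite /cyclic_sum /T_minus; expand.
ring: (cm1 x y) (cm1 x z) (cm1 y z) (cm2 x y) (cm2 x z) (cm2 y z).
Qed.

Lemma GH23P : W GH23 <-> [/\ tr = 0, v0 = 0 & sym_u_cond].
Proof.
split=> [[/GH234P ? /delta_omega_eq0P[? ?]]|[t0 v c]]; first by split.
by split; [exact/GH234P | exact/delta_omega_eq0P].
Qed.

(** * From coordinate conditions to subspaces of endomorphisms, and the resulting table *)

Lemma in_glP : in_gl I D <-> gl_cond.
Proof.
split=> [/lfunP DI x y|gl].
  by have := DI x; rewrite !comp_lfunE => ->; rewrite qIl.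
apply/lfunP => x; rewrite !comp_lfunE.
by apply: (@ip_inj _ _ q) => z; rewrite gl qIl.
Qed.

Lemma shiftE s x : (D - s *: \1%VF) x = D x - s *: x.
Proof. by rewrite add_lfunE opp_lfunE scale_lfunE id_lfunE. Qed.

Lemma in_gl_shift s : in_gl I (D - s *: \1%VF) <-> in_gl I D.
Proof.
rewrite /in_gl comp_lfunDl comp_lfunDr comp_lfunNl comp_lfunNr.
rewrite -comp_lfunZl -comp_lfunZr comp_lfun1l comp_lfun1r.
by split=> [/addIr|->].
Qed.

Lemma in_uP s : in_u q I (D - s *: \1%VF) <-> u_cond s.
Proof.
rewrite /in_u in_gl_shift in_glP.
split=> -[gl sk]; split=> // x y; have := sk x y.
  by rewrite opp_lfunE !shiftE !qE (ipC q x (D y)); lra.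
by rewrite opp_lfunE !shiftE !qE (ipC q x (D y)); lra.
Qed.

Lemma in_spP s : in_sp q I (D - s *: \1%VF) <-> sp_cond s.
Proof.
set X := D - s *: \1%VF.
have [Y XY] := frame_adjoint frame_pr X.
split=> [[Z XZ /lfunP ZX] x y|sp].
  have := congr1 (q^~ y) (ZX x).
  rewrite /= add_lfunE !comp_lfunE zero_lfunE ipDl ip0l (ipC q (Z _)) -XZ.
  by rewrite /X !shiftE !qE !qIl (qIC x y); lra.
exists Y => //; apply/lfunP => x; rewrite add_lfunE !comp_lfunE zero_lfunE.
apply: (@ip_inj _ _ q) => y; rewrite ipDl ip0l (ipC q (Y _)) -XY.
by have := sp x y; rewrite /X !shiftE !qE !qIl (qIC x y); lra.
Qed.

(** A self-adjoint summand does not contribute to [comm_form], and a skew one contributes twice its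
    commutator with [I]. Conversely, the symmetric and skew parts of [D] are the witnesses. *)
Lemma in_sym_plus_uP : in_sym_plus_u q I D <-> sym_u_cond.
Proof.
split=> [[S [B [symS [/lfunP BI skB] DE]]] x y|cm].
  have BIE z : B (I z) = I (B z) by have := BI z; rewrite !comp_lfunE.
  rewrite /comm_form DE !add_lfunE !BIE !qE !qIl.
  rewrite (symS x) (symS y) (ipC q x) (ipC q y (S _)); ring.
have [Y XY] := frame_adjoint frame_pr D.
exists (2^-1 *: (D + Y)), (2^-1 *: (D - Y)); split.
- move=> x y; rewrite !scale_lfunE !add_lfunE !qE (ipC q (Y x)) -!XY.
  by rewrite (ipC q x (D y)); ring.
- split.
    apply/lfunP => x; rewrite !comp_lfunE; apply: (@ip_inj _ _ q) => z.
    rewrite !scale_lfunE !add_lfunE !opp_lfunE qIl !qE.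
    rewrite (ipC q (Y x)) (ipC q (Y (I x))) -!XY.
    by have := cm x z; rewrite /comm_form; lra.
  move=> x y; rewrite !opp_lfunE !scale_lfunE !add_lfunE !opp_lfunE !qE.
  by rewrite (ipC q (Y x)) -!XY (ipC q x (D y)); ring.
apply/lfunP => x; rewrite !add_lfunE !scale_lfunE !add_lfunE !opp_lfunE.
by apply: (@ip_inj _ _ q) => z; rewrite !qE; field.
Qed.

Lemma gray_hervella_table :
  let D0 := D - tau *: \1%VF in
  [/\ W GH1 <-> W GH0,
      [/\ W GH12 <-> W GH2, W GH13 <-> W GH3 & W GH14 <-> W GH4],
      W GH124 <-> W GH24
    & W GH134 <-> W GH34] /\
  [/\ W GH0 <-> [/\ v0 = 0, w0 = 0 & in_u q I D],
      W GH2 <-> v0 = 0 /\ in_sp q I D,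
      W GH3 <-> [/\ tr = 0, v0 = 0, w0 = 0 & in_gl I D]
    & W GH4 <-> [/\ v0 = 0, w0 = 0 & in_u q I D0]] /\
  [/\ W GH23 <-> [/\ tr = 0, v0 = 0 & in_sym_plus_u q I D],
      W GH123 <-> tr = 0 /\ v0 = 0,
      W GH24 <-> v0 = 0 /\ in_sp q I D0
    & W GH34 <-> w0 = 0 /\ in_gl I D] /\
  [/\ W GH234 <-> in_sym_plus_u q I D
    & W GH1234 <-> True].
Proof.
(* The conditions on [D] itself are the shifted ones at [s = 0]. *)
move=> D0; have D_shift0 : D = D - 0 *: \1%VF by rewrite scale0r subr0.
have in_u0P := in_uP 0; have in_sp0P := in_spP 0.
rewrite -D_shift0 in in_u0P in_sp0P.
have and3iff P Q S S' : (S <-> S') -> [/\ P, Q & S'] <-> [/\ P, Q & S].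
  by move=> SS'; split=> -[? ? /SS'].
have and4iff P Q T S S' : (S <-> S') -> [/\ P, Q, T & S'] <-> [/\ P, Q, T & S].
  by move=> SS'; split=> -[? ? ? /SS'].
have and2iff P S S' : (S <-> S') -> P /\ S' <-> P /\ S.
  by move=> SS'; split=> -[? /SS'].
split; last split; last split; split=> //.
- exact: iff_trans GH1P (iff_sym GH0P).
- split.
  + exact: iff_trans T_plus_eqP (iff_sym GH2P).
  + exact: iff_trans GH13P (iff_sym GH3P).
  + exact: iff_trans GH14P (iff_sym GH4P).
- exact: iff_trans GH124P (iff_sym GH24P).
- exact: iff_trans GH134P (iff_sym GH34P).
- exact: iff_trans GH0P (and3iff _ _ _ _ in_u0P).
- exact: iff_trans GH2P (and2iff _ _ _ in_sp0P).
- exact: iff_trans GH3P (and4iff _ _ _ _ _ in_glP).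
- exact: iff_trans GH4P (and3iff _ _ _ _ (in_uP tau)).
- exact: iff_trans GH23P (and3iff _ _ _ _ in_sym_plus_uP).
- exact: delta_omega_eq0P.
- exact: iff_trans GH24P (and2iff _ _ _ (in_spP tau)).
- exact: iff_trans GH34P (and2iff _ _ _ in_glP).
- exact: iff_trans GH234P (iff_sym in_sym_plus_uP).
Qed.

End UnitaryFrame.

(** * The orthogonal splitting of an almost abelian algebra *)

Section AlmostAbelian.
Variables (R : realType) (g : vectType R).
Variables (br : {bilinear g -> g -> g}) (ip : {dot g for idfun}).
Variables (J : 'End(g)) (u : {vspace g}) (e0 : g).
Variables (mu : R) (v0 w0 : subvs_of (cplx_part J u)).
Variable D : 'End(subvs_of (cplx_part J u)).
Hypothesis brP : lie_bracket br.
Hypothesis uP : codim1_abelian_ideal br u.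
Hypothesis hermP : almost_hermitian ip J.
Hypothesis normalP : unit_normal ip u e0.
Hypothesis blockP : block_form br ip e0 mu v0 w0 D.

Local Notation q := (@ip_part R g ip J u).
Local Notation e1 := (J e0).
Local Notation V := (subvs_of (cplx_part J u)).
Local Notation vec := (@vec R g V e0 e1 (@vsval _ _ (cplx_part J u))).

Lemma JJ x : J (J x) = - x.
Proof. by case: hermP => /lfunP/(_ x); rewrite comp_lfunE opp_lfunE id_lfunE. Qed.

Lemma ipJl x y : ip (J x) y = - ip x (J y).
Proof. by case: hermP => _ JP; rewrite -(JP x (J y)) JJ ipNr opprK. Qed.

Lemma ipe00 : ip e0 e0 = 1. Proof. by case: normalP. Qed.

Lemma ipe11 : ip e1 e1 = 1. Proof. by case: hermP => _ ->; exact: ipe00. Qed.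

Lemma ipe01 : ip e0 e1 = 0.
Proof. by have := ipJl e0 e0; rewrite ipC; lra. Qed.

(** [u] is orthogonal to [e0] and has codimension one, so [u] and [e0] span everything; a vector
    orthogonal to [e0] then has no [e0]-component. *)
Lemma mem_uE x : (x \in u) = (ip e0 x == 0).
Proof.
apply/idP/eqP => [xu|x0]; first by case: normalP => _; apply.
have e0u : e0 \notin u.
  apply/negP => e0u; have [_ /(_ _ e0u)] := normalP.
  by rewrite ipe00 => /eqP; rewrite oner_eq0.
have : x \in (u + <[e0]>)%VS.
  suff -> : (u + <[e0]>)%VS = fullv by rewrite memvf.
  apply/eqP; rewrite eqEdim subvf /= -(let: And3 h _ _ := uP in h).
  rewrite dimv_disjoint_sum ?dim_vline ?addn1.
    by case: eqP e0u => [->|]; rewrite ?mem0v ?addn1.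
  apply/eqP; rewrite -subv0; apply/subvP => y; rewrite memv_cap.
  move=> /andP[yu /vlineP[k yk]]; have [_ /(_ _ yu)] := normalP.
  by rewrite yk ipZr ipe00 mulr1 memv0 => ->; rewrite scale0r.
move=> /memv_addP[y yu [z /vlineP[k ->] xE]].
move: x0; rewrite xE ipDr ipZr ipe00 mulr1.
by have [_ ->//] := normalP; rewrite add0r => ->; rewrite scale0r addr0.
Qed.

(** [x] lies in the image of [u] exactly when [J x] lies in [u], and [ip e1 x] is
    [- ip e0 (J x)]. *)
Lemma mem_cplxE x : (x \in cplx_part J u) = (ip e0 x == 0) && (ip e1 x == 0).
Proof.
rewrite memv_cap mem_uE; congr (_ && _).
rewrite ipJl oppr_eq0 -mem_uE; apply/memv_imgP/idP => [[y yu ->]|Jx].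
  by rewrite JJ memvN.
by exists (- J x); rewrite ?memvN// linearN/= JJ opprK.
Qed.

Lemma cplx_orth0 (x : V) : ip e0 (vsval x) = 0.
Proof. by have := subvsP x; rewrite mem_cplxE => /andP[/eqP]. Qed.

Lemma cplx_orth1 (x : V) : ip e1 (vsval x) = 0.
Proof. by have := subvsP x; rewrite mem_cplxE => /andP[_ /eqP]. Qed.

Lemma J_partE (x : V) : vsval (J_part J u x) = J (vsval x).
Proof.
rewrite lfunE /= vsprojK// mem_cplxE.
have := cplx_orth1 x; have := cplx_orth0 x; rewrite ipJl.
case: hermP => _ ->.
by move=> -> /eqP; rewrite oppr_eq0 => ->; rewrite eqxx.
Qed.

Lemma J_partK (x : V) : J_part J u (J_part J u x) = - x.
Proof. by apply: subvs_inj; rewrite !J_partE JJ. Qed.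

Lemma ip_part_J (x y : V) : q (J_part J u x) (J_part J u y) = q x y.
Proof. by case: hermP => _ JP; rewrite /ip_part !J_partE JP. Qed.

(** The difference already lies in the complex part; [vsproj] only changes its type. *)
Definition cplx_proj (X : g) : V := vsproj _ (X - ip X e0 *: e0 - ip X e1 *: e1).

Lemma vec_cplx_proj X : X = vec (ip X e0) (ip X e1) (cplx_proj X).
Proof.
rewrite /vec /cplx_proj/= vsprojK -[X - _ - _]addrA -opprD.
  by rewrite [RHS]addrC subrK.
rewrite mem_cplxE !(ipDr, ipNr, ipZr) !(ipC ip e1 e0) ipe00 ipe11 ipe01 !(ipC ip X).
by apply/andP; split; apply/eqP; ring.
Qed.

Lemma ip_vec t c x t' c' x' :
  ip (vec t c x) (vec t' c' x') = t * t' + c * c' + q x x'.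
Proof.
have o0 (y : V) : ip (vsval y) e0 = 0 by rewrite ipC cplx_orth0.
have o1 (y : V) : ip (vsval y) e1 = 0 by rewrite ipC cplx_orth1.
rewrite /vec /= !(ipDl, ipDr, ipZl, ipZr) !cplx_orth0 !cplx_orth1 !o0 !o1.
by rewrite (ipC ip e1 e0) ipe00 ipe11 ipe01 /ip_part; ring.
Qed.

Lemma J_vec t c x : J (vec t c x) = vec (- c) t (J_part J u x).
Proof.
rewrite /vec !linearD !linearZ/= JJ J_partE scalerN scaleNr; congr (_ + _).
exact: addrC.
Qed.

Lemma brC x y : br x y = - br y x.
Proof.
case: brP => brxx _; have := brxx (x + y).
rewrite linearDl/= !linearDr/= !brxx add0r addr0 => /eqP.
by rewrite addr_eq0 => /eqP.
Qed.

Lemma br_vec t c x t' c' x' :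
  br (vec t c x) (vec t' c' x') =
  vec 0 (t * (mu * c' + q w0 x') - t' * (mu * c + q w0 x))
    (t *: (c' *: v0 + D x') - t' *: (c *: v0 + D x)).
Proof.
have [brxx _] := brP; have [_ _ ab] := uP; have [br01 br0x] := blockP.
have e1u : e1 \in u by rewrite mem_uE ipe01.
have xu (y : V) : vsval y \in u by rewrite mem_uE cplx_orth0.
have br0 s (y : V) : br e0 (s *: e1 + vsval y) =
    (mu * s + q w0 y) *: e1 + vsval (s *: v0 + D y).
  rewrite linearDr linearZr_LR /= br01 br0x scalerDr scalerA.
  by rewrite [in RHS]scalerDl (mulrC mu) addrACA.
have memu s (y : V) : s *: e1 + vsval y \in u by rewrite memvD ?memvZ.
(* As [u] is abelian and the bracket alternating, only brackets with [e0] survive. *)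
have brl a b X Y : X \in u -> Y \in u ->
    br (a *: e0 + X) (b *: e0 + Y) = a *: br e0 Y - b *: br e0 X.
  move=> Xu Yu; rewrite linearDl linearZl_LR/= 2!linearDr 2!linearZr_LR /=.
  by rewrite brxx (ab X Y)// (brC X) scaler0 add0r addr0 scalerN.
rewrite /vec/= -!addrA brl ?memu// !br0 scale0r add0r !scalerDr !scalerA.
rewrite [(_ - _) *: _]scalerBl opprD.
by rewrite addrACA.
Qed.
End AlmostAbelian.

(** * The table for an almost Hermitian almost abelian algebra *)

Theorem theorem4p2 (R : realType) (n : nat) (g : vectType R)
    (br : {bilinear g -> g -> g}) (ip : {dot g for idfun}) (J : 'End(g))
    (u : {vspace g}) (e0 : g) (nabla : g -> g -> g) (f : seq g)
    (mu : R) (v0 w0 : subvs_of (cplx_part J u))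
    (D : 'End(subvs_of (cplx_part J u))) :
  (3 <= n)%N ->
  \dim {:g} = (2 * n)%N ->
  lie_bracket br ->
  codim1_abelian_ideal br u ->
  almost_hermitian ip J ->
  unit_normal ip u e0 ->
  block_form br ip e0 mu v0 w0 D ->
  levi_civita br ip nabla ->
  orthonormal_basis ip f ->
  let W := gray_hervella n br ip J nabla f in
  let q := @ip_part R g ip J u in
  let J' := J_part J u in
  let D0 := D - (lftrace D / (2 * (n%:R - 1))) *: \1%VF in
  [/\ W GH1 <-> W GH0,
      [/\ W GH12 <-> W GH2, W GH13 <-> W GH3 & W GH14 <-> W GH4],
      W GH124 <-> W GH24
    & W GH134 <-> W GH34] /\
  [/\ W GH0 <-> [/\ v0 = 0, w0 = 0 & in_u q J' D],
      W GH2 <-> v0 = 0 /\ in_sp q J' D,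
      W GH3 <-> [/\ lftrace D = 0, v0 = 0, w0 = 0 & in_gl J' D]
    & W GH4 <-> [/\ v0 = 0, w0 = 0 & in_u q J' D0]] /\
  [/\ W GH23 <-> [/\ lftrace D = 0, v0 = 0 & in_sym_plus_u q J' D],
      W GH123 <-> lftrace D = 0 /\ v0 = 0,
      W GH24 <-> v0 = 0 /\ in_sp q J' D0
    & W GH34 <-> w0 = 0 /\ in_gl J' D] /\
  [/\ W GH234 <-> in_sym_plus_u q J' D
    & W GH1234 <-> True].
Proof.
move=> n3 _ brP uP hermP normalP blockP nablaP fP.
have m0 : n%:R - 1 != 0 :> R.
  by apply/eqP; have : 3%:R <= n%:R :> R by [rewrite ler_nat]; lra.
(* The coordinates along [e0] and [J e0] are inner products, [m] is [n - 1], and [tau] is found by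
   unification with the goal. *)
apply: (@gray_hervella_table _ _ _ ip br J _ _ e0 (J e0) vsval mu v0 w0 D
  (ip^~ e0) (ip^~ (J e0)) (cplx_proj ip J u e0) _ _ _ _ _ _ nabla _ f _ n _
  (n%:R - 1)) => //.
- exact: vec_cplx_proj uP hermP normalP.
- exact: ip_vec uP hermP normalP.
- exact: J_vec uP hermP normalP.
- exact: br_vec brP uP hermP normalP blockP.
- exact: J_partK uP hermP normalP.
- exact: ip_part_J uP hermP normalP.
- move=> X Y; rewrite [in LHS](orthonormal_basis_expansion X fP) ip_suml.
  by apply: eq_bigr => e _; rewrite ipZl.
- by move=> c; field.
Qed.
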